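(* Let $q$ be a prime power, let $E_1=\mathbb{F}_q^{n_1}$ and $E_2=\mathbb{F}_q^{n_2}$, and let $M_1=(E_1,\rho_1)$ and $M_2=(E_2,\rho_2)$ be transversal $q$-matroids with respective presentations $\mathcal{X}_1=(A_1,\dots,A_k)$ and $\mathcal{X}_2=(B_1,\dots,B_\ell)$. If $M_1$ and $M_2$ are coordinate $q$-matroids, then the direct sum $M_1\oplus M_2$ is a coordinate transversal $q$-matroid with presentation $$\mathcal{X}_1\oplus\mathcal{X}_2=(A_1\oplus E_2,\dots,A_k\oplus E_2,\;E_1\oplus B_1,\dots,E_1\oplus B_\ell).$$
   Context: A $q$-matroid $M=(E,\rho)$ consists of a finite-dimensional vector space $E$ over a finite field $\mathbb{F}_q$ and a function $\rho$ from the set of subspaces of $E$ to $\mathbb{Z}_{\ge 0}$ such that for all $X,Y\le E$: $0\le\rho(X)\le\dim X$; $X\le Y$ implies $\rho(X)\le\rho(Y)$; and $\rho(X+Y)+\rho(X\cap Y)\le\rho(X)+\rho(Y)$. A subspace $X$ is independent if $\rho(X)=\dim X$; it is a flat if $\rho(X)<\rho(X\oplus\langle v\rangle)$ for all $v\in E\setminus X$; it is cyclic if $\rho(H)=\rho(X)$ for every subspace $H\le X$ with $\dim H=\dim X-1$; it is a cyclic flat if it is both. A subspace of $\mathbb{F}_q^n$ is coordinate if it is spanned by a subset of the standard basis vectors. A coordinate $q$-matroid is a $q$-matroid on $\mathbb{F}_q^n$ all of whose cyclic flats are coordinate subspaces. Given a finite family (repetitions allowed) $\mathcal{A}$ of $k$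 subsets of a set, a finite set $X$ has an avoidance transversal of $\mathcal{A}$ if there are orderings $X=\{x_1,\dots,x_\ell\}$ and $\mathcal{A}=(A_1,\dots,A_k)$, with $\ell\le k$, such that $x_i\notin A_i$ for each $i\in[\ell]$. For a finite family $\mathcal{X}$ of subspaces of $E$, a subspace $X\le E$ is a partial $q$-transversal of $\mathcal{X}$ if every linear basis of $X$ has an avoidance transversal of $\mathcal{X}$. The transversal $q$-matroid on $E$ with presentation $\mathcal{X}$ is the $q$-matroid whose independent spaces are exactly the partial $q$-transversals of $\mathcal{X}$. For vector spaces $E_1,E_2$ over the same field, $\pi_i$ denotes the projection $E_1\oplus E_2\to E_i$, and for $X_i\le E_i$, $X_1\oplus X_2$ denotes the corresponding subspace of $E_1\oplus E_2$; $\mathbb{F}_q^{n_1}\oplus\mathbb{F}_q^{n_2}$ is identified with $\mathbb{F}_q^{n_1+n_2}$ by concatenating coordinates. The direct sum of $q$-matroids $M_1=(E_1,\rho_1)$ and $M_2=(E_2,\rho_2)$ is the $q$-matroid $M_1\oplus M_2=(E_1\oplus E_2,\rho)$ with $$\rho(X)=\min\{\rho_1(\pi_1(Y))+\rho_2(\pi_2(Y))+\dim(X)-\dim(Y):Y\le X\}.$$ *)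

(* Defs.v *)
From HB Require Import structures.
From mathcomp Require Import all_boot all_order all_algebra all_fingroup.

Set Implicit Arguments.
Unset Strict Implicit.
Unset Printing Implicit Defensive.

Import GRing.Theory.

Local Open Scope vspace_scope.
Local Open Scope nat_scope.

(* Over a finite field the subspaces form a finite type, so that minima over
   subspaces can be taken with [arg min_...]. *)
Section FiniteSubspaces.
Import VectorInternalTheory.
Variables (F : finFieldType) (E : vectType F).
HB.instance Definition _ := [Countable of {vspace E} by <:].
HB.instance Definition _ := [Finite of {vspace E} by <:].
End FiniteSubspaces.

Record qmatroid (F : finFieldType) (E : vectType F) := QMatroid {
  qrank :> {vspace E} -> nat;
  qrank_le_dim : forall X, qrank X <= \dim X;
  qrank_mono : forall X Y, (X <= Y)%VS -> qrank X <= qrank Y;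
  qrank_submod : forall X Y,
    qrank (X + Y)%VS + qrank (X :&: Y)%VS <= qrank X + qrank Y
}.

Definition independent (F : finFieldType) (E : vectType F) (M : qmatroid E)
    (X : {vspace E}) : Prop :=
  M X = \dim X.

Definition flat (F : finFieldType) (E : vectType F) (M : qmatroid E)
    (X : {vspace E}) : Prop :=
  forall v : E, v \notin X -> M X < M (X + <[v]>)%VS.

Definition cyclic (F : finFieldType) (E : vectType F) (M : qmatroid E)
    (X : {vspace E}) : Prop :=
  forall H : {vspace E}, (H <= X)%VS -> (\dim H).+1 = \dim X -> M H = M X.

Definition cyclic_flat (F : finFieldType) (E : vectType F) (M : qmatroid E)
    (X : {vspace E}) : Prop :=
  cyclic M X /\ flat M X.

Definition coordinate_subspace (F : finFieldType) (n : nat)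
    (X : {vspace 'rV[F]_n}) : Prop :=
  exists S : {set 'I_n}, X = (\sum_(i in S) <[delta_mx 0%R i]>)%VS.

Definition coordinate_qmatroid (F : finFieldType) (n : nat)
    (M : qmatroid 'rV[F]_n) : Prop :=
  forall X, cyclic_flat M X -> coordinate_subspace X.

(* [x] is the ordering of the finite set [X]; since repetitions are allowed in
   the family [A], an ordering of it is a permutation [s] of its indices. *)
Definition avoidance_transversal (T : eqType) (k : nat) (A : 'I_k -> {pred T})
    (X : {pred T}) : Prop :=
  exists (l : nat) (x : l.-tuple T) (s : 'S_k) (le_lk : l <= k),
    [/\ uniq x, x =i X & forall i : 'I_l, tnth x i \notin A (s (widen_ord le_lk i))].

Definition partial_qtransversal (F : finFieldType) (E : vectType F) (k : nat)
    (A : k.-tuple {vspace E}) (X : {vspace E}) : Prop :=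
  forall b : seq E, basis_of X b ->
    avoidance_transversal (fun i => [pred v | v \in tnth A i]) [pred v | v \in b].

(* [M] is the transversal q-matroid with presentation [A]. *)
Definition presented_by (F : finFieldType) (E : vectType F) (k : nat)
    (M : qmatroid E) (A : k.-tuple {vspace E}) : Prop :=
  forall X, independent M X <-> partial_qtransversal A X.

(* F^n1 (+) F^n2 is identified with F^(n1 + n2) through [row_mx]. *)
Definition proj1v (F : finFieldType) (n1 n2 : nat) :
    'Hom('rV[F]_(n1 + n2), 'rV[F]_n1) := linfun lsubmx.

Definition proj2v (F : finFieldType) (n1 n2 : nat) :
    'Hom('rV[F]_(n1 + n2), 'rV[F]_n2) := linfun rsubmx.

Definition dsumv (F : finFieldType) (n1 n2 : nat) (X1 : {vspace 'rV[F]_n1})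
    (X2 : {vspace 'rV[F]_n2}) : {vspace 'rV[F]_(n1 + n2)} :=
  (proj1v F n1 n2 @^-1: X1 :&: proj2v F n1 n2 @^-1: X2)%VS.

Lemma mem_dsumv (F : finFieldType) (n1 n2 : nat) (X1 : {vspace 'rV[F]_n1})
    (X2 : {vspace 'rV[F]_n2}) (u : 'rV[F]_n1) (v : 'rV[F]_n2) :
  (row_mx u v \in dsumv X1 X2) = (u \in X1) && (v \in X2).
Proof.
by rewrite memv_cap -!memv_preim !lfunE /= row_mxKl row_mxKr.
Qed.

Definition dsum_value (F : finFieldType) (n1 n2 : nat)
    (M1 : qmatroid 'rV[F]_n1) (M2 : qmatroid 'rV[F]_n2)
    (X Y : {vspace 'rV[F]_(n1 + n2)}) : nat :=
  M1 (proj1v F n1 n2 @: Y)%VS + M2 (proj2v F n1 n2 @: Y)%VS + (\dim X - \dim Y).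

Definition dsum_rank (F : finFieldType) (n1 n2 : nat)
    (M1 : qmatroid 'rV[F]_n1) (M2 : qmatroid 'rV[F]_n2)
    (X : {vspace 'rV[F]_(n1 + n2)}) : nat :=
  dsum_value M1 M2 X
    [arg min_(Y < (0%VS : {vspace 'rV[F]_(n1 + n2)}) | (Y <= X)%VS)
      dsum_value M1 M2 X Y].

Lemma dsum_rank_min (F : finFieldType) (n1 n2 : nat)
    (M1 : qmatroid 'rV[F]_n1) (M2 : qmatroid 'rV[F]_n2)
    (X Y : {vspace 'rV[F]_(n1 + n2)}) :
  (Y <= X)%VS -> dsum_rank M1 M2 X <= dsum_value M1 M2 X Y.
Proof.
rewrite /dsum_rank => sYX; case: arg_minnP => [|Z _]; first exact: sub0v.
exact.
Qed.

Lemma dsum_rank_attained (F : finFieldType) (n1 n2 : nat)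
    (M1 : qmatroid 'rV[F]_n1) (M2 : qmatroid 'rV[F]_n2)
    (X : {vspace 'rV[F]_(n1 + n2)}) :
  exists2 Y, (Y <= X)%VS & dsum_rank M1 M2 X = dsum_value M1 M2 X Y.
Proof.
rewrite /dsum_rank; case: arg_minnP => [|Z sZX _]; first exact: sub0v.
by exists Z.
Qed.

Lemma dsum_rank_le_dim (F : finFieldType) (n1 n2 : nat)
    (M1 : qmatroid 'rV[F]_n1) (M2 : qmatroid 'rV[F]_n2)
    (X : {vspace 'rV[F]_(n1 + n2)}) :
  dsum_rank M1 M2 X <= \dim X.
Proof.
apply: leq_trans (dsum_rank_min M1 M2 (sub0v X)) _.
have h1 := qrank_le_dim M1 0%VS; have h2 := qrank_le_dim M2 0%VS.
move: h1 h2; rewrite /dsum_value !limg0 !dimv0 subn0 !leqn0.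
by move=> /eqP-> /eqP->.
Qed.

Lemma dsum_rank_mono (F : finFieldType) (n1 n2 : nat)
    (M1 : qmatroid 'rV[F]_n1) (M2 : qmatroid 'rV[F]_n2)
    (X X' : {vspace 'rV[F]_(n1 + n2)}) :
  (X <= X')%VS -> dsum_rank M1 M2 X <= dsum_rank M1 M2 X'.
Proof.
move=> sXX'; have [Y sYX' ->] := dsum_rank_attained M1 M2 X'.
apply: leq_trans (dsum_rank_min M1 M2 (capvSl X Y)) _.
rewrite /dsum_value !leq_add ?qrank_mono ?limgS ?capvSr //.
have sXYX' : (X + Y <= X')%VS by rewrite subv_add sXX'.
apply: leq_trans (leq_sub2r _ (dimvS sXYX')).
rewrite leq_subLR addnBA ?dimvS ?addvSr //.
by rewrite [X in _ <= X - _]addnC dimv_sum_cap addnK.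
Qed.

Lemma dsum_rank_submod (F : finFieldType) (n1 n2 : nat)
    (M1 : qmatroid 'rV[F]_n1) (M2 : qmatroid 'rV[F]_n2)
    (X X' : {vspace 'rV[F]_(n1 + n2)}) :
  dsum_rank M1 M2 (X + X')%VS + dsum_rank M1 M2 (X :&: X')%VS
    <= dsum_rank M1 M2 X + dsum_rank M1 M2 X'.
Proof.
have [Y sY ->] := dsum_rank_attained M1 M2 X.
have [Y' sY' ->] := dsum_rank_attained M1 M2 X'.
have sD := addvS sY sY'; have sI := capvS sY sY'.
apply: leq_trans (leq_add (dsum_rank_min M1 M2 sD) (dsum_rank_min M1 M2 sI)) _.
have img_submod (n : nat) (M : qmatroid 'rV[F]_n)
    (f : 'Hom('rV[F]_(n1 + n2), 'rV[F]_n)) :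
  M (f @: (Y + Y'))%VS + M (f @: (Y :&: Y'))%VS
    <= M (f @: Y)%VS + M (f @: Y')%VS.
  apply: leq_trans (qrank_submod M _ _).
  rewrite limgD leq_add2l; apply: qrank_mono.
  by rewrite subv_cap !limgS ?capvSl ?capvSr.
rewrite /dsum_value addnACA [leqRHS]addnACA leq_add //.
  by rewrite addnACA [leqRHS]addnACA leq_add.
rewrite -(leq_add2r (\dim (Y + Y')%VS + \dim (Y :&: Y')%VS)).
rewrite addnACA !subnK ?dimvS // !dimv_sum_cap.
by rewrite addnACA !subnK ?dimvS.
Qed.

Definition dsum_qmatroid (F : finFieldType) (n1 n2 : nat)
    (M1 : qmatroid 'rV[F]_n1) (M2 : qmatroid 'rV[F]_n2) :
    qmatroid 'rV[F]_(n1 + n2) :=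
  QMatroid (@dsum_rank_le_dim F n1 n2 M1 M2) (@dsum_rank_mono F n1 n2 M1 M2)
    (@dsum_rank_submod F n1 n2 M1 M2).

Definition dsum_presentation (F : finFieldType) (n1 n2 k l : nat)
    (A : k.-tuple {vspace 'rV[F]_n1}) (B : l.-tuple {vspace 'rV[F]_n2}) :
    (k + l).-tuple {vspace 'rV[F]_(n1 + n2)} :=
  [tuple of [seq dsumv X fullv | X <- A] ++ [seq dsumv fullv Y | Y <- B]].

(* Main.v *)
Require Import Defs.
From mathcomp Require Import all_boot all_order all_algebra.
From mathcomp Require Import perm zify.

(* By Hall's marriage theorem, X is a partial q-transversal of A exactly when
   dim Y <= f_A(Y) for every Y <= X, where f_A(Y) is the number of members of A
   not containing Y.  Since f_A is monotone and submodular, a q-matroid with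
   presentation A has rank min {f_A(Y) + dim X - dim Y : Y <= X}.  The function
   of the direct sum presentation is f(Y) = f_A(pi_1 Y) + f_B(pi_2 Y).  If
   dim Y <= f(Y) for every Y <= X, and Z_i attains the rank of pi_i Y, then
   applying this bound to Y :&: (Z_1 (+) Z_2), whose codimension in Y is at most
   the sum of the codimensions of the Z_i, gives
   dim Y <= rho_1(pi_1 Y) + rho_2(pi_2 Y), so X is independent in M_1 (+) M_2.
   Finally, a cyclic flat X of M_1 (+) M_2 is pi_1 X (+) pi_2 X with both
   projections cyclic flats. *)

Set Implicit Arguments.
Unset Strict Implicit.
Unset Printing Implicit Defensive.

(** * Hall's marriage theorem for finite bipartite graphs *)

Section Hall.
Variables T U : finType.
Implicit Types (N : {ffun T -> {set U}}) (S : {set T}).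

Definition neighbourhood N S : {set U} := \bigcup_(x in S) N x.

Definition hall_condition N := forall S, #|S| <= #|neighbourhood N S|.

Definition delete_edge N (x : T) (a : U) : {ffun T -> {set U}} :=
  [ffun y => if y == x then (N x) :\ a else N y].

Lemma neighbourhood_sup N (S : {set T}) y : y \in S ->
  N y \subset neighbourhood N S.
Proof. exact: bigcup_sup. Qed.

Lemma neighbourhood_delete N x a (S : {set T}) : x \in S ->
  neighbourhood (delete_edge N x a) S =
    (N x :\ a) :|: neighbourhood N (S :\ x).
Proof.
move=> xS; rewrite /neighbourhood (big_setD1 x) //= ffunE eqxx.
by congr (_ :|: _); apply: eq_bigr => y; rewrite !inE ffunE => /andP[/negPf->].
Qed.

(** A set violating Hall's condition after the deletion must contain [x], since the other
    neighbourhoods are unchanged. Here [S] is that set without [x], which weakens the strict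
    inequality to [<=]. *)
Lemma hall_violator N x a : hall_condition N ->
    ~ hall_condition (delete_edge N x a) ->
  exists2 S : {set T}, x \notin S & #|(N x :\ a) :|: neighbourhood N S| <= #|S|.
Proof.
move=> hN hNa.
have /forallPn[S] : ~~ [forall S : {set T},
    #|S| <= #|neighbourhood (delete_edge N x a) S|].
  by apply/negP => /forallP.
rewrite -ltnNge; have [xS|xS] := boolP (x \in S); last first.
  rewrite /neighbourhood (eq_bigr N) => [|y yS]; first by rewrite ltnNge hN.
  by rewrite ffunE (negPf (memPn xS _ yS)).
rewrite neighbourhood_delete // (cardsD1 x) xS add1n ltnS => le_S.
by exists (S :\ x) => //; rewrite setD11.
Qed.

(* If two edges x-a and x-b could not be deleted, the violating sets would
   contradict Hall's condition by submodularity of the neighbourhood size. *)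
Lemma hall_delete N x a b : hall_condition N -> a != b ->
    a \in N x -> b \in N x ->
  hall_condition (delete_edge N x a) \/ hall_condition (delete_edge N x b).
Proof.
move=> hN neq_ab aN bN.
have hallP c : hall_condition (delete_edge N x c) \/
    ~ hall_condition (delete_edge N x c).
  case: (boolP [forall S : {set T},
    #|S| <= #|neighbourhood (delete_edge N x c) S|]) => [/forallP|h].
    by left.
  by right => h'; case/negP: h; apply/forallP.
have [|na] := hallP a; first by left.
have [|nb] := hallP b; first by right.
have [S xS leS] := hall_violator hN na.
have [S' xS' leS'] := hall_violator hN nb.
have := leq_add leS leS'; rewrite -cardsUI -[leqRHS]cardsUI leqNgt => /negP[].
(* As [a != b], the sets [N x :\ a] and [N x :\ b] together cover [N x], so Hall's condition can be
   applied to [S :|: S'] with [x] added. That extra element gives the strict inequality. *)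
rewrite -addSn leq_add //.
  have xSS : x \notin S :|: S' by rewrite inE negb_or xS.
  rewrite -[#|_|.+1]/(true + #|S :|: S'|) -xSS -cardsU1.
  apply: leq_trans (hN _) (subset_leq_card _).
  apply/bigcupsP => y; rewrite !inE => /predU1P[->|/orP[yS|yS]].
  - apply/subsetP => c cN; rewrite !inE cN !andbT.
    by case: eqP => [->|//]; rewrite neq_ab !orbT.
  - by rewrite subsetU // subsetU // neighbourhood_sup ?orbT.
  - by rewrite setUC subsetU // subsetU // neighbourhood_sup ?orbT.
apply: leq_trans (hN _) (subset_leq_card _).
apply/bigcupsP => y; rewrite inE => /andP[yS yS']; rewrite subsetI.
by rewrite !subsetU ?neighbourhood_sup ?orbT.
Qed.

(** Induction on the number of edges, deleting one while some [N x] has two elements. Once every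
    [N x] has at most one, Hall's condition on singletons gives [f] and on pairs its injectivity. *)
Lemma hall_marriage N : hall_condition N ->
  exists2 f : T -> U, injective f & forall x, f x \in N x.
Proof.
have [n] := ubnP (\sum_x #|N x|); elim: n N => // n IHn N leNn hN.
have [/forallP le1|] := boolP [forall x, #|N x| <= 1].
  have /fin_all_exists[f Nf] x : exists a, N x = [set a].
    apply/cards1P; rewrite eqn_leq le1.
    by have := hN [set x]; rewrite /neighbourhood big_set1 cards1.
  exists f => [x y eq_f|x]; last by rewrite Nf set11.
  apply/eqP/negPn/negP => neq_xy; have := hN [set x; y].
  by rewrite /neighbourhood bigcup_setU !big_set1 cards2 neq_xy !Nf eq_f setUid
    cards1.
case/forallPn => x; rewrite -ltnNge => /card_gt1P[a [b [aN bN neq_ab]]].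
have step c : c \in N x -> hall_condition (delete_edge N x c) ->
    exists2 f : T -> U, injective f & forall y, f y \in N y.
  move=> cN hNc; have [||f inj_f fN] := IHn (delete_edge N x c) => //.
    rewrite -ltnS (leq_trans _ leNn) // ltnS (bigD1 x) //=.
    rewrite [ltnRHS](bigD1 x) //= ffunE eqxx [#|N x|](cardsD1 c) cN.
    rewrite -addnA add1n ltnS leq_add2l leq_sum // => y /negPf.
    by rewrite ffunE => ->.
  exists f => // y; have := fN y; rewrite ffunE; case: eqP => // ->.
  by rewrite inE => /andP[].
by have [] := hall_delete hN neq_ab aN bN; apply: step.
Qed.

End Hall.

(** Turns a matching into the ordering that [avoidance_transversal] asks for: the values of [f] come
    first, then the remaining indices. *)
Lemma injection_extends_perm (m n : nat) (f : 'I_m -> 'I_n) : injective f ->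
  exists (le_mn : m <= n) (s : 'S_n), forall i, s (widen_ord le_mn i) = f i.
Proof.
move=> inj_f; have le_mn : m <= n.
  by have := leq_card f inj_f; rewrite !card_ord.
exists le_mn; pose t := codom f ++ [seq j <- enum 'I_n | j \notin codom f].
have /tuple_permP[s def_t] : perm_eq t (ord_tuple n).
  rewrite val_ord_tuple uniq_perm ?enum_uniq //.
    rewrite cat_uniq (map_inj_uniq inj_f) enum_uniq filter_uniq ?enum_uniq //=.
    rewrite andbT.
    by apply/hasPn => j; rewrite mem_filter => /andP[].
  by move=> j; rewrite mem_cat mem_filter mem_enum andbT orbN.
exists s => i; have lt_i : i < size (codom f) by rewrite size_codom card_ord.
have := congr1 (fun u => nth (f i) u (widen_ord le_mn i)) def_t.
rewrite -tnth_nth tnth_mktuple tnth_ord_tuple => <-.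
rewrite nth_cat lt_i codomE (nth_map i) ?size_enum_ord ?(ltn_ord i) //.
by congr (f _); apply: nth_ord_enum.
Qed.

(** * Ranks determined by independent spaces, and ranks induced by submodular functions *)

Section InducedRank.
Variables (F : finFieldType) (E : vectType F).
Implicit Types (M : qmatroid E) (X Y Z I : {vspace E}) (f : {vspace E} -> nat).

Lemma dimv_add_line X v : v \notin X -> \dim (X + <[v]>) = (\dim X).+1.
Proof.
move=> vX; have v0 : v != 0%R by apply: contraNneq vX => ->; apply: mem0v.
rewrite dimv_disjoint_sum ?dim_vline ?v0 ?addn1 //.
apply/eqP; rewrite -subv0; apply/subvP => w /memv_capP[wX /vlineP[c def_w]].
rewrite memv0 def_w GRing.scaler_eq0 (negPf v0) orbF; apply: contraNT vX => c0.
by move: wX; rewrite def_w GRing.rpredZeq (negPf c0).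
Qed.

Lemma hyperplane_above Y X : (Y <= X)%VS -> Y != X ->
  exists H : {vspace E}, [/\ (Y <= H)%VS, (H <= X)%VS & (\dim H).+1 = \dim X].
Proof.
move=> sYX neq_YX; pose P Z := [&& (Y <= Z)%VS, (Z <= X)%VS & Z != X].
have PY : P Y by rewrite /P subvv sYX.
have [H /and3P[sYH sHX neq_HX] /= maxH] := arg_maxnP (fun Z => \dim Z) PY.
exists H; split=> //; have /subvPn[v vX vH] : ~~ (X <= H)%VS.
  by apply: contra neq_HX => sXH; rewrite eqEsubv sHX.
have sHv : (H + <[v]> <= X)%VS by rewrite subv_add sHX -memvE.
rewrite -(dimv_add_line vH); congr (\dim _); apply/eqP/negPn/negP => neq_Hv.
have /maxH : P (H + <[v]>)%VS.
  by rewrite /P sHv neq_Hv (subv_trans sYH) // addvSl.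
by rewrite /= dimv_add_line // ltnn.
Qed.

(** Submodularity for [X] and [I + <[v]>], whose intersection contains [I]. *)
Lemma qrank_add_line M X v I : (I <= X)%VS ->
  M (I + <[v]>)%VS = M I -> M (X + <[v]>)%VS = M X.
Proof.
move=> sIX eq_Iv; apply/eqP; rewrite eqn_leq andbC qrank_mono ?addvSl //.
rewrite -(leq_add2r (M I)) -{2}eq_Iv; apply: leq_trans (qrank_submod M _ _).
rewrite addvA (addv_idPl sIX) leq_add2l qrank_mono //.
by rewrite subv_cap sIX addvSl.
Qed.

Lemma qrank_closure M I X : (I <= X)%VS ->
  (forall v, v \in X -> M (I + <[v]>)%VS = M I) -> M X = M I.
Proof.
move=> sIX clI; pose P Z := [&& (I <= Z)%VS, (Z <= X)%VS & M Z == M I].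
have PI : P I by rewrite /P subvv sIX /=.
have [H /and3P[sIH sHX /eqP eqH] /= maxH] := arg_maxnP (fun Z => \dim Z) PI.
have [sXH|/subvPn[v vX vH]] := boolP (X <= H)%VS.
  by rewrite -eqH; congr (M _); apply/eqP; rewrite eqEsubv sXH.
have /maxH : P (H + <[v]>)%VS.
  rewrite /P (subv_trans sIH) ?addvSl // subv_add sHX -memvE vX /=.
  by rewrite (qrank_add_line sIH) ?eqH // clI.
by rewrite /= dimv_add_line // ltnn.
Qed.

(** For [I] independent of largest dimension in [X], no line of [X] raises the rank of [I], as
    otherwise [I + <[v]>] would be independent too. Then [qrank_closure] applies. *)
Lemma qrank_attained_independent M X :
  exists2 I : {vspace E}, (I <= X)%VS & independent M I /\ \dim I = M X.
Proof.
pose P Z := (Z <= X)%VS && (M Z == \dim Z).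
have P0 : P 0%VS by rewrite /P sub0v eqn_leq qrank_le_dim dimv0.
have [I /andP[sIX /eqP indI] /= maxI] := arg_maxnP (fun Z => \dim Z) P0.
exists I => //; split; rewrite // -indI; symmetry.
apply: qrank_closure => // v vX; have [vI|vI] := boolP (v \in I).
  by congr (M _); apply/addv_idPl.
apply/eqP; rewrite eqn_leq andbC qrank_mono ?addvSl // leqNgt.
apply/negP => lt_I.
have /maxI : P (I + <[v]>)%VS.
  rewrite /P subv_add sIX -memvE vX eqn_leq qrank_le_dim dimv_add_line //.
  by rewrite -indI.
by rewrite /= dimv_add_line // ltnn.
Qed.

Lemma independent_dim_le_qrank M I X :
  (I <= X)%VS -> independent M I -> \dim I <= M X.
Proof. by move=> sIX <-; apply: qrank_mono. Qed.

Lemma qrank_le_of_independent M M' X :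
  (forall I, independent M I -> independent M' I) -> M X <= M' X.
Proof.
move=> sMM'; have [I sIX [indI <-]] := qrank_attained_independent M X.
exact: independent_dim_le_qrank (sMM' _ indI).
Qed.

Definition induced_value f X Y := f Y + (\dim X - \dim Y).

(** A relation rather than a formula for [r], so that it covers a given q-matroid as well as
    [induced_rank] and [dsum_qmatroid]. *)
Definition rank_induced_by (r f : {vspace E} -> nat) := forall X,
  (forall Y, (Y <= X)%VS -> r X <= induced_value f X Y) /\
  (exists2 Y, (Y <= X)%VS & r X = induced_value f X Y).

(** The value at [Y] is at least [\dim X] exactly when [\dim Y <= f Y]. *)
Lemma independent_induced M f X : rank_induced_by M f ->
  independent M X <-> (forall Y, (Y <= X)%VS -> \dim Y <= f Y).
Proof.
move=> /(_ X)[leM [Z sZX eqM]]; split=> [indX Y sYX | le_f].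
  have := leM _ sYX; rewrite /induced_value indX.
  have := dimvS sYX; lia.
apply/eqP; rewrite eqn_leq qrank_le_dim eqM /induced_value.
have := le_f _ sZX; have := dimvS sZX; lia.
Qed.

Variable f : {vspace E} -> nat.
Hypothesis f0 : f 0%VS = 0.
Hypothesis f_mono : forall X Y, (X <= Y)%VS -> f X <= f Y.
Hypothesis f_submod :
  forall X Y, f (X + Y)%VS + f (X :&: Y)%VS <= f X + f Y.

Definition induced_rank X : nat :=
  induced_value f X
    [arg min_(Y < (0%VS : {vspace E}) | (Y <= X)%VS) induced_value f X Y].

Lemma induced_rankP : rank_induced_by induced_rank f.
Proof.
move=> X; rewrite /induced_rank; case: arg_minnP => [|Y sYX minY].
  exact: sub0v.
by split=> //; exists Y.
Qed.

Lemma induced_rank_le_dim X : induced_rank X <= \dim X.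
Proof.
have [/(_ _ (sub0v X)) le0 _] := induced_rankP X; apply: leq_trans le0 _.
by rewrite /induced_value f0 leq_subr.
Qed.

Lemma induced_rank_mono X X' : (X <= X')%VS ->
  induced_rank X <= induced_rank X'.
Proof.
move=> sXX'; have [_ [Y sYX' ->]] := induced_rankP X'.
(* The minimizer [Y] for [X'] is cut down to [X]: the codimension of [X :&: Y] in [X] is at most
   that of [Y] in [X']. *)
have [/(_ _ (capvSl X Y)) le_cap _] := induced_rankP X.
apply: leq_trans le_cap _.
apply: leq_add; first by rewrite f_mono ?capvSr.
have /dimvS : (X + Y <= X')%VS by rewrite subv_add sXX'.
have := dimv_sum_cap X Y; lia.
Qed.

Lemma induced_rank_submod X X' :
  induced_rank (X + X')%VS + induced_rank (X :&: X')%VS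
    <= induced_rank X + induced_rank X'.
Proof.
have [_ [Y sY ->]] := induced_rankP X; have [_ [Y' sY' ->]] := induced_rankP X'.
have [/(_ _ (addvS sY sY')) leD _] := induced_rankP (X + X')%VS.
have [/(_ _ (capvS sY sY')) leI _] := induced_rankP (X :&: X')%VS.
apply: leq_trans (leq_add leD leI) _; rewrite /induced_value.
have := f_submod Y Y'; have := dimv_sum_cap X X'; have := dimv_sum_cap Y Y'.
have := dimvS (addvS sY sY'); have := dimvS (capvS sY sY').
have := dimvS sY; have := dimvS sY'; lia.
Qed.

Definition induced_qmatroid : qmatroid E :=
  QMatroid induced_rank_le_dim induced_rank_mono induced_rank_submod.

(** [induced_qmatroid] has the same independent spaces as [M], hence the same rank function. *)
Lemma rank_induced M :
    (forall X, independent M X <-> (forall Y, (Y <= X)%VS -> \dim Y <= f Y)) ->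
  rank_induced_by M f.
Proof.
move=> indM X; have indN I : independent induced_qmatroid I <-> independent M I.
  by rewrite indM; apply: independent_induced => Y; apply: induced_rankP.
suff -> : M X = induced_qmatroid X by apply: induced_rankP.
by apply/eqP; rewrite eqn_leq !qrank_le_of_independent // => I /indN.
Qed.

End InducedRank.

(** * Hall's criterion for partial q-transversals *)

Section Avoidance.
Variables (F : finFieldType) (E : vectType F).
Implicit Types (X Y : {vspace E}).

Definition avoid_count (A : seq {vspace E}) Y : nat :=
  count (fun X => ~~ (Y <= X)%VS) A.

Lemma avoid_count0 A : avoid_count A 0%VS = 0.
Proof.
rewrite /avoid_count (eq_count (a2 := pred0)) ?count_pred0 // => X.
by rewrite sub0v.
Qed.

Lemma avoid_count_mono A X Y : (X <= Y)%VS ->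
  avoid_count A X <= avoid_count A Y.
Proof.
by move=> sXY; apply: sub_count => Z; apply: contra; apply: subv_trans.
Qed.

(** Member by member: [X + Y] escapes [Z] iff [X] or [Y] does, and if [X :&: Y] escapes [Z] then
    both do. *)
Lemma avoid_count_submod A X Y :
  avoid_count A (X + Y)%VS + avoid_count A (X :&: Y)%VS
    <= avoid_count A X + avoid_count A Y.
Proof.
rewrite /avoid_count -[leqRHS]count_predUI leq_add // sub_count // => Z /=.
  by rewrite subv_add negb_and.
rewrite -negb_or; apply: contra.
by case/orP; apply: subv_trans; rewrite ?capvSl ?capvSr.
Qed.

Lemma avoid_count_card k (A : k.-tuple {vspace E}) Y :
  avoid_count A Y = #|[set j | ~~ (Y <= tnth A j)%VS]|.
Proof.
rewrite cardE size_filter -enumT /avoid_count.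
rewrite -[X in count _ X](map_tnth_enum A) count_map.
by apply: eq_count => j; rewrite /= inE.
Qed.

Lemma basis_extension X Y : (Y <= X)%VS ->
  exists2 b : seq E, basis_of X b & {subset vbasis Y <= b}.
Proof.
move=> sYX; exists (vbasis (X :\: Y)%VS ++ vbasis Y); last first.
  by move=> v vY; rewrite mem_cat vY orbT.
rewrite -[X in basis_of X _](addv_idPl sYX) -addv_diff.
apply: cat_basis; rewrite ?vbasisP //.
by apply/directv_addP; apply: capv_diff.
Qed.

Lemma partial_qtransversalP k (A : k.-tuple {vspace E}) X :
  partial_qtransversal A X <->
    (forall Y, (Y <= X)%VS -> \dim Y <= avoid_count A Y).
Proof.
split=> [trX Y sYX | leA b basb].
  have [b basb sYb] := basis_extension sYX.
  have [m [x [s [le_mk [ux eq_xb avx]]]]] := trX b basb.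
  (* The indices matched to the basis vectors of [Y]: there are at least [\dim Y] of them, and each
     gives a member that misses a vector of [Y]. *)
  pose J := [set s (widen_ord le_mk i) | i : 'I_m & tnth x i \in vbasis Y].
  rewrite avoid_count_card; apply: (@leq_trans #|J|); last first.
    apply: subset_leq_card; apply/subsetP => _ /imsetP[i + ->].
    rewrite !inE => iY.
    by apply: contra (avx i) => sYA; apply: subvP sYA _ (vbasis_mem iY).
  rewrite card_imset; last by move=> i j /perm_inj/(congr1 val)/= /val_inj.
  apply: (@leq_trans (size (vbasis Y))); first by rewrite size_tuple.
  rewrite cardE -(size_map (tnth x)).
  apply: uniq_leq_size; first exact: free_uniq (basis_free (vbasisP Y)).
  move=> v vY; have /tnthP[i def_v] : v \in x by rewrite eq_xb; apply: sYb.
  by rewrite def_v map_f // mem_enum inE -def_v.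
have free_b := basis_free basb; have ub := free_uniq free_b.
pose N := [ffun i : 'I_(size b) =>
  [set j | tnth (in_tuple b) i \notin tnth A j]].
have hallN : hall_condition N.
  (* A member containing all the vectors selected by [S] contains their span, so [leA] on that span
     yields Hall's condition for [S]. Listing the vectors as a filter of [b] lets them inherit
     freeness. *)
  move=> S; pose e := [seq tnth (in_tuple b) i | i in S].
  pose c := [seq v <- b | v \in e].
  have sub_eb : {subset e <= b} by move=> _ /imageP[i _ ->]; apply: mem_tnth.
  have le_Sc : #|S| <= size c.
    rewrite -(size_image (tnth (in_tuple b)) (mem S)); apply: uniq_leq_size.
      by rewrite map_inj_uniq ?enum_uniq //; apply/tuple_uniqP.
    by move=> v ve; rewrite mem_filter ve sub_eb.
  have /eqP dim_c : free c by apply: filter_free.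
  have s_cX : (<<c>> <= X)%VS.
    apply/span_subvP => v; rewrite mem_filter => /andP[_].
    exact: basis_mem basb.
  apply: leq_trans le_Sc _; rewrite -dim_c.
  apply: leq_trans (leA _ s_cX) _; rewrite avoid_count_card.
  apply: subset_leq_card; apply/subsetP => j; rewrite inE; apply: contraR => jS.
  apply/span_subvP => v; rewrite mem_filter => /andP[/imageP[i iS ->] _].
  by apply: contraR jS => bjA; apply/bigcupP; exists i; rewrite // ffunE inE.
have [f inj_f fN] := hall_marriage hallN.
have [le_bk [s sf]] := injection_extends_perm inj_f.
exists (size b), (in_tuple b), s, le_bk; split=> // i.
by have := fN i; rewrite ffunE !inE sf.
Qed.

Lemma presented_induced k (M : qmatroid E)
    (A : k.-tuple {vspace E}) :
  presented_by M A -> rank_induced_by M (avoid_count A).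
Proof.
move=> presA; apply: rank_induced.
- exact: avoid_count0.
- exact: avoid_count_mono.
- exact: avoid_count_submod.
by move=> X; rewrite presA; apply: partial_qtransversalP.
Qed.

End Avoidance.

(** Rank-nullity for [g] on [Y] and on its cut by the preimage of [Z]: both meet the kernel in the
    same subspace. Thus the codimension of [Z] is preserved. *)
Lemma dimv_cap_preim (K : fieldType) (aT rT : vectType K) (g : 'Hom(aT, rT))
    (Y : {vspace aT}) (Z : {vspace rT}) : (Z <= g @: Y)%VS ->
  \dim (Y :&: g @^-1: Z) + \dim (g @: Y) = \dim Y + \dim Z.
Proof.
move=> sZY; rewrite -(limg_ker_dim g (Y :&: g @^-1: Z)) -(limg_ker_dim g Y).
have -> : (Y :&: g @^-1: Z :&: lker g = Y :&: lker g)%VS.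
  rewrite -capvA; congr (_ :&: _)%VS; apply/capv_idPr.
  by rewrite -lpreim0 lpreimS ?sub0v.
have -> : (g @: (Y :&: g @^-1: Z) = Z)%VS.
  apply/eqP; rewrite eqEsubv; apply/andP; split; apply/subvP => w.
    by case/memv_imgP => u /memv_capP[_ uZ] ->; rewrite memv_preim.
  move=> wZ; have /memv_imgP[u uY def_w] := subvP sZY _ wZ.
  by rewrite def_w memv_img // memv_cap uY -memv_preim -def_w.
by rewrite addnAC.
Qed.

Lemma mem_coordinateP (F : finFieldType) n (S : {set 'I_n}) (u : 'rV[F]_n) :
  reflect (forall j, j \notin S -> u 0%R j = 0%R)
    (u \in (\sum_(i in S) <[delta_mx 0%R i]>)%VS).
Proof.
apply: (iffP idP) => [/memv_sumP[c c_line ->] j jS | u0].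
  rewrite summxE big1 // => i iS; have /vlineP[a ->] := c_line i iS.
  by rewrite !mxE eqxx /= eq_sym (negPf (memPn jS i iS)) GRing.mulr0.
rewrite [u]row_sum_delta; apply: memv_suml => j _.
have [jS|/u0->] := boolP (j \in S); last by rewrite GRing.scale0r mem0v.
by apply: memvZ; rewrite memvE (sumv_sup j).
Qed.

(** * The direct sum: dimensions, cyclic flats and presentation *)

Section DirectSum.
Variables (F : finFieldType) (n1 n2 : nat).
Notation V := 'rV[F]_(n1 + n2).
Notation pr1 := (proj1v F n1 n2).
Notation pr2 := (proj2v F n1 n2).

Lemma proj1v_row_mx u v : pr1 (row_mx u v) = u.
Proof. by rewrite lfunE /= row_mxKl. Qed.

Lemma proj2v_row_mx u v : pr2 (row_mx u v) = v.
Proof. by rewrite lfunE /= row_mxKr. Qed.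

Lemma sub_dsumv X X1 X2 :
  (X <= dsumv X1 X2)%VS = (pr1 @: X <= X1)%VS && (pr2 @: X <= X2)%VS.
Proof.
apply/subvP/andP => [sX | [/subvP sX1 /subvP sX2] w wX].
  by split; apply/subvP => _ /memv_imgP[w /sX + ->];
    rewrite memv_cap -!memv_preim => /andP[].
by rewrite memv_cap -!memv_preim sX1 ?sX2 ?memv_img.
Qed.

Lemma proj1v_dsumv X1 X2 : (pr1 @: dsumv X1 X2)%VS = X1.
Proof.
apply/eqP; rewrite eqEsubv.
have := subvv (dsumv X1 X2); rewrite sub_dsumv => /andP[-> _] /=.
apply/subvP => u uX1; rewrite -[u](proj1v_row_mx u 0%R) memv_img //.
by rewrite mem_dsumv uX1 mem0v.
Qed.

Lemma proj2v_dsumv X1 X2 : (pr2 @: dsumv X1 X2)%VS = X2.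
Proof.
apply/eqP; rewrite eqEsubv.
have := subvv (dsumv X1 X2); rewrite sub_dsumv => /andP[_ ->] /=.
apply/subvP => u uX2; rewrite -[u](proj2v_row_mx 0%R u) memv_img //.
by rewrite mem_dsumv uX2 mem0v.
Qed.

Lemma dsumvS (X1 Y1 : {vspace 'rV[F]_n1}) (X2 Y2 : {vspace 'rV[F]_n2}) :
  (X1 <= Y1)%VS -> (X2 <= Y2)%VS -> (dsumv X1 X2 <= dsumv Y1 Y2)%VS.
Proof. by move=> s1 s2; rewrite sub_dsumv proj1v_dsumv proj2v_dsumv s1. Qed.

Lemma dim_dsumv (X1 : {vspace 'rV[F]_n1}) (X2 : {vspace 'rV[F]_n2}) :
  \dim (dsumv X1 X2) = \dim X1 + \dim X2.
Proof.
rewrite -(limg_ker_dim pr1) proj1v_dsumv addnC; congr (_ + _).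
rewrite -(limg_ker_dim pr2).
have -> : (dsumv X1 X2 :&: lker pr1 :&: lker pr2 = 0)%VS.
  apply/eqP; rewrite -subv0; apply/subvP => w.
  rewrite !memv_cap !memv_ker => /andP[/andP[_ /eqP w1] /eqP w2].
  move: w1 w2; rewrite !lfunE /= => w1 w2.
  by rewrite -[w]hsubmxK w1 w2 row_mx0 memv0.
rewrite dimv0 add0n; congr (\dim _).
apply/eqP; rewrite eqEsubv; apply/andP; split.
  rewrite -[X in (_ <= X)%VS](proj2v_dsumv X1) limgS ?capvSl //.
apply/subvP => u uX2; rewrite -[u](proj2v_row_mx 0%R u) memv_img //.
by rewrite memv_cap mem_dsumv uX2 mem0v memv_ker proj1v_row_mx eqxx.
Qed.

(** The two preimages cut [Y] in subspaces whose codimensions are given by [dimv_cap_preim], and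
    codimension is subadditive under intersection. The additive form avoids truncated
    subtraction. *)
Lemma dim_le_cap_dsumv (Y : {vspace V}) Z1 Z2 :
    (Z1 <= pr1 @: Y)%VS -> (Z2 <= pr2 @: Y)%VS ->
  \dim Y + (\dim Z1 + \dim Z2)
    <= \dim (Y :&: dsumv Z1 Z2) + (\dim (pr1 @: Y) + \dim (pr2 @: Y)).
Proof.
move=> sZ1 sZ2.
have e1 : \dim (Y :&: pr1 @^-1: Z1) + \dim (pr1 @: Y) = \dim Y + \dim Z1.
  exact: dimv_cap_preim.
have e2 : \dim (Y :&: pr2 @^-1: Z2) + \dim (pr2 @: Y) = \dim Y + \dim Z2.
  exact: dimv_cap_preim.
have := dimv_sum_cap (Y :&: pr1 @^-1: Z1) (Y :&: pr2 @^-1: Z2).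
have -> : (Y :&: pr1 @^-1: Z1 :&: (Y :&: pr2 @^-1: Z2) = Y :&: dsumv Z1 Z2)%VS.
  by apply/vspaceP => w; rewrite !memv_cap andbACA andbb.
have /dimvS : (Y :&: pr1 @^-1: Z1 + Y :&: pr2 @^-1: Z2 <= Y)%VS.
  by rewrite subv_add !capvSl.
lia.
Qed.

Lemma dsum_rank_induced M1 M2 : rank_induced_by (dsum_qmatroid M1 M2)
  (fun Y => M1 (pr1 @: Y)%VS + M2 (pr2 @: Y)%VS).
Proof.
move=> X; split; first exact: dsum_rank_min.
exact: dsum_rank_attained.
Qed.

Lemma dsum_rank_le M1 M2 X :
  dsum_qmatroid M1 M2 X <= M1 (pr1 @: X)%VS + M2 (pr2 @: X)%VS.
Proof.
have [/(_ _ (subvv X))] := dsum_rank_induced M1 M2 X.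
by rewrite /induced_value subnn addn0.
Qed.

(* The minimum defining the rank of a cyclic space is attained only at the
   space itself, since it would be smaller on a hyperplane containing any
   other minimizer. *)
Lemma dsum_rank_cyclic M1 M2 X : cyclic (dsum_qmatroid M1 M2) X ->
  dsum_qmatroid M1 M2 X = M1 (pr1 @: X)%VS + M2 (pr2 @: X)%VS.
Proof.
move=> cycX; have [_ [Y sYX eqX]] := dsum_rank_induced M1 M2 X.
have [eq_YX|/(hyperplane_above sYX)[H [sYH sHX dimH]]] := eqVneq Y X.
  by rewrite eqX /induced_value eq_YX subnn addn0.
have [/(_ _ sYH) + _] := dsum_rank_induced M1 M2 H.
rewrite (cycX H sHX dimH) eqX /induced_value -dimH.
have := dimvS sYH; lia.
Qed.

(** By [dsum_rank_cyclic] the rank of [X] is an upper bound for the rank of the sum of its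
    projections, which contains [X]; flatness makes the two equal. *)
Lemma cyclic_flat_dsum M1 M2 X : cyclic_flat (dsum_qmatroid M1 M2) X ->
  [/\ X = dsumv (pr1 @: X) (pr2 @: X), cyclic_flat M1 (pr1 @: X)
    & cyclic_flat M2 (pr2 @: X)].
Proof.
case=> cycX flatX; have rkX := dsum_rank_cyclic cycX.
set X1 := (pr1 @: X)%VS in rkX *; set X2 := (pr2 @: X)%VS in rkX *.
have sXD : (X <= dsumv X1 X2)%VS by rewrite sub_dsumv !subvv.
have rk_le Y1 Y2 : dsum_qmatroid M1 M2 (dsumv Y1 Y2) <= M1 Y1 + M2 Y2.
  by apply: leq_trans (dsum_rank_le _ _ _) _; rewrite proj1v_dsumv proj2v_dsumv.
have flatD Y : (X <= Y)%VS ->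
    dsum_qmatroid M1 M2 Y <= dsum_qmatroid M1 M2 X -> Y = X.
  move=> sXY leYX; apply/eqP; rewrite eqEsubv sXY andbT.
  apply/subvP => v vY; apply/negPn/negP => /flatX.
  rewrite ltnNge => /negP[]; apply: leq_trans leYX; apply: qrank_mono.
  by rewrite subv_add sXY -memvE.
have defX : dsumv X1 X2 = X by apply: flatD; rewrite // rkX.
have cycD Y : (Y <= X)%VS -> (\dim Y).+1 = \dim X ->
    M1 X1 + M2 X2 <= dsum_qmatroid M1 M2 Y.
  by move=> sYX dimY; rewrite (cycX Y) // rkX.
split=> //; split.
(* A hyperplane [H] of [X1] gives the hyperplane [dsumv H X2] of [X], which has full rank by
   cyclicity. *)
- move=> H sHX dimH; apply/eqP; rewrite eqn_leq qrank_mono //=.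
  rewrite -(leq_add2r (M2 X2)); apply: leq_trans (rk_le _ _).
  by apply: cycD; rewrite -defX ?dsumvS // !dim_dsumv -dimH.
(* If [v] did not raise the rank of [X1], enlarging the first summand by [v] would not raise the
   rank of [X], so flatness of [X] would put [v] in [X1]. *)
- move=> v vX1; rewrite ltnNge; apply/negP => le_v; case/negP: vX1.
  have eqD : dsumv (X1 + <[v]>) X2 = X.
    apply: flatD; first by rewrite (subv_trans sXD) // dsumvS ?addvSl.
    by rewrite rkX (leq_trans (rk_le _ _)) // leq_add2r.
  by rewrite -(proj1v_dsumv X1 X2) defX -eqD proj1v_dsumv memvE addvSr.
- move=> H sHX dimH; apply/eqP; rewrite eqn_leq qrank_mono //=.
  rewrite -(leq_add2l (M1 X1)); apply: leq_trans (rk_le _ _).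
  by apply: cycD; rewrite -defX ?dsumvS // !dim_dsumv -dimH addnS.
- move=> v vX2; rewrite ltnNge; apply/negP => le_v; case/negP: vX2.
  have eqD : dsumv X1 (X2 + <[v]>) = X.
    apply: flatD; first by rewrite (subv_trans sXD) // dsumvS ?addvSl.
    by rewrite rkX (leq_trans (rk_le _ _)) // leq_add2l.
  by rewrite -(proj2v_dsumv X1 X2) defX -eqD proj2v_dsumv memvE addvSr.
Qed.

Lemma coordinate_dsumv (X1 : {vspace 'rV[F]_n1}) (X2 : {vspace 'rV[F]_n2}) :
    coordinate_subspace X1 -> coordinate_subspace X2 ->
  coordinate_subspace (dsumv X1 X2).
Proof.
case=> S1 -> [S2 ->].
pose S := [set j |
  match split j with inl i => i \in S1 | inr i => i \in S2 end].
have S_l i : (lshift n2 i \in S) = (i \in S1) by rewrite inE (unsplitK (inl i)).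
have S_r i : (rshift n1 i \in S) = (i \in S2) by rewrite inE (unsplitK (inr i)).
exists S; apply/vspaceP => w; rewrite -[w]hsubmxK mem_dsumv.
apply/andP/mem_coordinateP => [[/mem_coordinateP u0] | w0].
  move=> /mem_coordinateP v0 j; case: (split_ordP j) => i ->.
    by rewrite S_l row_mxEl; apply: u0.
  by rewrite S_r row_mxEr; apply: v0.
split; apply/mem_coordinateP => i.
  by rewrite -S_l => /w0; rewrite row_mxEl.
by rewrite -S_r => /w0; rewrite row_mxEr.
Qed.

Lemma coordinate_dsum (M1 : qmatroid 'rV[F]_n1) (M2 : qmatroid 'rV[F]_n2) :
  coordinate_qmatroid M1 -> coordinate_qmatroid M2 ->
  coordinate_qmatroid (dsum_qmatroid M1 M2).
Proof.
move=> co1 co2 X /cyclic_flat_dsum[defX /co1 coX1 /co2 coX2]; rewrite defX.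
exact: coordinate_dsumv.
Qed.

Lemma avoid_count_dsum k l (A : k.-tuple {vspace 'rV[F]_n1})
    (B : l.-tuple {vspace 'rV[F]_n2}) Y :
  avoid_count (dsum_presentation A B) Y =
    avoid_count A (pr1 @: Y)%VS + avoid_count B (pr2 @: Y)%VS.
Proof.
rewrite /avoid_count count_cat !count_map; congr (_ + _);
  apply: eq_count => Z /=.
  by rewrite sub_dsumv subvf andbT.
by rewrite sub_dsumv subvf.
Qed.

Lemma presented_dsum k l M1 M2 (A : k.-tuple {vspace 'rV[F]_n1})
    (B : l.-tuple {vspace 'rV[F]_n2}) :
  presented_by M1 A -> presented_by M2 B ->
  presented_by (dsum_qmatroid M1 M2) (dsum_presentation A B).
Proof.
move=> /presented_induced rk1 /presented_induced rk2 X.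
rewrite partial_qtransversalP (independent_induced _ (dsum_rank_induced M1 M2)).
split=> le_dim Y sYX.
  (* Each rank is at most its avoidance count: take the whole projection as competitor in the
     minimum. *)
  apply: leq_trans (le_dim Y sYX) _; rewrite avoid_count_dsum leq_add //.
    by have [/(_ _ (subvv _))] := rk1 (pr1 @: Y)%VS;
      rewrite /induced_value subnn addn0.
  by have [/(_ _ (subvv _))] := rk2 (pr2 @: Y)%VS;
    rewrite /induced_value subnn addn0.
have [_ [Z1 sZ1 ->]] := rk1 (pr1 @: Y)%VS.
have [_ [Z2 sZ2 ->]] := rk2 (pr2 @: Y)%VS; rewrite /induced_value.
(* The projections of [W] lie in [Z1] and [Z2], so the bound at [W] involves at most the counts at
   these minimizers. *)
pose W := (Y :&: dsumv Z1 Z2)%VS.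
have /(avoid_count_mono A) le1 : (pr1 @: W <= Z1)%VS.
  by rewrite -[X in (_ <= X)%VS](proj1v_dsumv _ Z2) limgS ?capvSr.
have /(avoid_count_mono B) le2 : (pr2 @: W <= Z2)%VS.
  by rewrite -[X in (_ <= X)%VS](proj2v_dsumv Z1) limgS ?capvSr.
(* Adding these dimensions cancels the truncated subtractions in the two minimal values. *)
rewrite -(leq_add2r (\dim Z1 + \dim Z2)).
apply: leq_trans (dim_le_cap_dsumv sZ1 sZ2) _.
rewrite [leqRHS]addnACA -[X in _ <= X + _]addnA -[X in _ <= _ + X]addnA.
rewrite !subnK ?dimvS //.
rewrite [leqRHS]addnACA leq_add2r.
apply: leq_trans (le_dim W (subv_trans (capvSl _ _) sYX)) _.
by rewrite avoid_count_dsum leq_add.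
Qed.

End DirectSum.

Theorem theorem4p7 (F : finFieldType) (n1 n2 k l : nat)
    (M1 : qmatroid 'rV[F]_n1) (M2 : qmatroid 'rV[F]_n2)
    (A : k.-tuple {vspace 'rV[F]_n1}) (B : l.-tuple {vspace 'rV[F]_n2}) :
  presented_by M1 A -> presented_by M2 B ->
  coordinate_qmatroid M1 -> coordinate_qmatroid M2 ->
  coordinate_qmatroid (dsum_qmatroid M1 M2) /\
  presented_by (dsum_qmatroid M1 M2) (dsum_presentation A B).
Proof.
move=> presA presB co1 co2.
by split; [apply: coordinate_dsum | apply: presented_dsum].
Qed.
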